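(* Let $G$ be a Lie group with finitely many connected components, $H\subset G$ a closed subgroup, and $X:=G/H$; assume that $X$ admits a nonzero relatively $G$-invariant measure. Let $\rho\colon G\to GL(V)$ be a continuous representation of $G$ on a finite dimensional real vector space $V$ and let $v_0\in V$ be an $H$-fixed vector. Let $\Theta\subset V^\vee\times W_0(G,H)$ and $\mathcal{P}=\{p_\theta\}_{\theta\in\Theta}$ be the parameter set and the family of probability measures on $X$ obtained from $(G,H,V,v_0)$ by the method described in the context. If $\Theta$ is not empty, then $\mathcal{P}$ is an exponential family on $X$.
   Context: Relatively invariant measures: $G$ acts on the set $\mathcal{R}(X)$ of Radon measures on $X$ by pushforward, $(g\cdot\nu)(B)=\nu(g^{-1}B)$. A measure $\nu\in\mathcal{R}(X)$ is relatively $G$-invariant if there is a map $\chi\colon G\to\mathbb{R}_{>0}$ (the multiplier of $\nu$) with $d(g\cdot\nu)(x)=\chi(g)^{-1}d\nu(x)$ for all $g\in G$. The method: put $W_0(G,H):=\{\tau\colon G\to\mathbb{R}\mid \tau \text{ is a continuous group homomorphism with }\tau|_H=0\}$ and let $V^\vee$ be the dual space of $V$. Take a nonzero relatively $G$-invariant measure $\nu$ on $X=G/H$ (the family below does not depend on the choice of $\nu$). For $\theta=(\varphi,\tau)\in V^\vee\times W_0(G,H)$ and $x=gH\in X$, set $\rho(x)v_0:=\rho(g)v_0$ and $\tau(x):=\tau(g)$ (well-defined since $v_0$ is $H$-fixed and $\tau|_H=0$) and $$d\tilde p_\theta(x):=\exp(-\langle\varphi,\rho(x)v_0\rangle+\tau(x))\,d\nu(x).$$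 Put $\Theta:=\{\theta\in V^\vee\times W_0(G,H)\mid \int_X d\tilde p_\theta<\infty\}$ and, for $\theta\in\Theta$, $c_\theta:=(\int_X d\tilde p_\theta)^{-1}$ and $p_\theta:=c_\theta\tilde p_\theta$. The family obtained is $\mathcal{P}:=\{p_\theta\}_{\theta\in\Theta}$. Exponential family: let $X$ be a manifold and $\mathcal{R}(X)$ the set of Radon measures on $X$. A non-empty subset $\mathcal{P}\subset\mathcal{R}(X)$ consisting of probability measures is called an exponential family on $X$ if there exists a triple $(\mu,E,T)$ such that: (1) $\mu\in\mathcal{R}(X)$; (2) $E$ is a finite dimensional real vector space; (3) $T\colon X\to E$ is a continuous map; (4) for any $p\in\mathcal{P}$ there exists $\eta\in E^\vee$ such that $dp(x)=c_\eta e^{-\langle\eta,T(x)\rangle}d\mu(x)$, where $c_\eta:=\left(\int_{x\in X}e^{-\langle\eta,T(x)\rangle}d\mu(x)\right)^{-1}$. *)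

(* Defs.v *)
From HB Require Import structures.
From mathcomp Require Import all_boot all_order all_algebra.
From mathcomp Require Import all_classical all_reals all_analysis.

Set Implicit Arguments.
Unset Strict Implicit.
Unset Printing Implicit Defensive.

Import Order.TTheory GRing.Theory Num.Theory.
Import numFieldNormedType.Exports.

Local Open Scope classical_set_scope.
Local Open Scope ring_scope.
Local Open Scope quotient_scope.

(* [U] is meant to be open. *)
Fixpoint Ck_on (R : realType) (V W : normedModType R) (k : nat)
    (U : set V) (f : V -> W) : Prop :=
  match k with
  | 0 => forall x, U x -> {for x, continuous f}
  | k'.+1 => forall v : V,
      (forall x, U x -> derivable f x v) /\ Ck_on k' U (fun x => 'D_v f x)
  end.

Definition smooth_on (R : realType) (V W : normedModType R)
  (U : set V) (f : V -> W) : Prop := forall k, Ck_on k U f.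

(* The two maps are total functions, only meaningful on [chart_dom] and on
   [chart_img] respectively. *)
Record chart (R : realType) (M : topologicalType) (n : nat) := Chart {
  chart_dom : set M;
  chart_map : M -> 'rV[R]_n;
  chart_inv : 'rV[R]_n -> M
}.

Definition chart_img (R : realType) (M : topologicalType) (n : nat)
  (c : chart R M n) : set 'rV[R]_n := chart_map c @` chart_dom c.

Record is_chart (R : realType) (M : topologicalType) (n : nat)
    (c : chart R M n) : Prop := IsChart {
  chart_dom_open : open (chart_dom c);
  chart_img_open : open (chart_img c);
  chart_mapK : forall x, chart_dom c x -> chart_inv c (chart_map c x) = x;
  chart_map_continuous :
    forall x, chart_dom c x -> {for x, continuous (chart_map c)};
  chart_inv_continuous :
    forall y, chart_img c y -> {for y, continuous (chart_inv c)}
}.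

Record is_smooth_atlas (R : realType) (M : topologicalType) (n : nat)
    (A : set (chart R M n)) : Prop := IsSmoothAtlas {
  atlas_chart : forall c, A c -> is_chart c;
  atlas_cover : forall x : M, exists2 c, A c & chart_dom c x;
  atlas_compat : forall c d, A c -> A d ->
    smooth_on (chart_map c @` (chart_dom c `&` chart_dom d))
              (chart_map d \o chart_inv c)
}.

(* Smoothness of the multiplication M * M -> M and of the inversion M -> M,
   read in the charts of [A] (products of charts on M * M). *)
Definition smooth_mul (R : realType) (M : topologicalType) (n : nat)
    (A : set (chart R M n)) (mul : M -> M -> M) : Prop :=
  forall a b c, A a -> A b -> A c ->
    let m (z : 'rV[R]_(n + n)) :=
      mul (chart_inv a (lsubmx z)) (chart_inv b (rsubmx z)) in
    smooth_on
      [set z | [/\ chart_img a (lsubmx z), chart_img b (rsubmx z)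
                 & chart_dom c (m z)]]
      (chart_map c \o m).

Definition smooth_inv (R : realType) (M : topologicalType) (n : nat)
    (A : set (chart R M n)) (inv : M -> M) : Prop :=
  forall a c, A a -> A c ->
    let i := inv \o chart_inv a in
    smooth_on [set z | chart_img a z /\ chart_dom c (i z)] (chart_map c \o i).

HB.mixin Record isTopologicalGroup G & Topological G & Group G := {
  topgroup_mul_continuous : continuous (fun x : G * G => (x.1 * x.2)%g);
  topgroup_inv_continuous : continuous (fun x : G => x^-1%g)
}.

#[short(type="topologicalGroupType")]
HB.structure Definition TopologicalGroup :=
  {G of Topological G & Group G & isTopologicalGroup G}.

(* All components of a Lie group have the same dimension, so a single
   [lie_dim] loses no generality. *)
HB.mixin Record isLieGroup (R : realType) G & TopologicalGroup G := {
  lie_dim : nat;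
  lie_atlas : set (chart R G lie_dim);
  lie_hausdorff : hausdorff_space G;
  lie_second_countable : @second_countable G;
  lie_smooth_atlas : is_smooth_atlas lie_atlas;
  lie_mul_smooth : smooth_mul lie_atlas (fun x y : G => (x * y)%g);
  lie_inv_smooth : smooth_inv lie_atlas (fun x : G => x^-1%g)
}.

#[short(type="lieGroupType")]
HB.structure Definition LieGroup (R : realType) :=
  {G of TopologicalGroup G & isLieGroup R G}.

Definition finitely_many_components (T : topologicalType) : Prop :=
  finite_set (range (connected_component [set: T])).

Section CosetSpace.
Context {G : topologicalGroupType}.
Variable H : groupClosed G.

Definition left_coset_rel (x y : G) : bool := (x^-1 * y)%g \in H.

Lemma left_coset_rel_refl : reflexive left_coset_rel.
Proof. by move=> x; rewrite /left_coset_rel mulVg gpred1. Qed.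

Lemma left_coset_rel_sym : symmetric left_coset_rel.
Proof.
move=> x y; rewrite /left_coset_rel.
by rewrite -[in RHS]gpredV invgM invgK.
Qed.

Lemma left_coset_rel_trans : transitive left_coset_rel.
Proof.
move=> y x z; rewrite /left_coset_rel => xy yz.
have -> : (x^-1 * z)%g = ((x^-1 * y) * (y^-1 * z))%g.
  by rewrite -mulgA mulVKg.
exact: gpredM.
Qed.

Canonical left_coset_equiv := EquivRel left_coset_rel
  left_coset_rel_refl left_coset_rel_sym left_coset_rel_trans.

(* The space G/H of left cosets gH, with the quotient topology and with
   the coset H as distinguished point. *)
Definition coset_space : Type :=
  quotient_topology {eq_quot left_coset_rel}.

HB.instance Definition _ := Topological.on coset_space.
HB.instance Definition _ := Quotient.on coset_space.
HB.instance Definition _ :=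
  isPointed.Build coset_space (\pi_coset_space 1%g).

Definition coset_act (g : G) (x : coset_space) : coset_space :=
  \pi_coset_space (g * repr x)%g.

End CosetSpace.

Definition borel (X : ptopologicalType) : Type :=
  g_sigma_algebraType (@open X).
HB.instance Definition _ (X : ptopologicalType) := Measurable.on (borel X).

Record is_radon (R : realType) (X : ptopologicalType)
    (mu : {measure set (borel X) -> \bar R}) : Prop := IsRadon {
  radon_compact : forall K : set X, compact K -> (mu K < +oo)%E;
  radon_outer : forall B : set (borel X), measurable B ->
    mu B = ereal_inf [set mu U | U in [set U : set X | open U /\ B `<=` U]];
  radon_inner : forall U : set X, open U ->
    mu U = ereal_sup [set mu K | K in [set K : set X | compact K /\ K `<=` U]]
}.

Definition relatively_invariant (R : realType) (G : topologicalGroupType)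
    (H : groupClosed G) (nu : {measure set (borel (coset_space H)) -> \bar R}) :
  Prop :=
  is_radon nu /\
  exists chi : G -> R, (forall g, 0 < chi g) /\
    forall g (B : set (borel (coset_space H))), measurable B ->
      pushforward nu
        (coset_act g : borel (coset_space H) -> borel (coset_space H)) B
      = (((chi g)^-1)%:E * nu B)%E.

(* A finite dimensional real vector space with its canonical topology,
   obtained from R^n by transport along a coordinate isomorphism. *)
Definition fdtop (R : realType) (E : vectType R) : Type :=
  initial_topology (passmx.rVof (vbasis (fullv : {vspace E}))).
HB.instance Definition _ (R : realType) (E : vectType R) :=
  Topological.on (fdtop E).

(* A continuous representation G -> GL(V), with values in End(V): the two
   algebraic laws already force every [rho g] to be invertible. *)
Record is_continuous_representation (R : realType) (G : topologicalGroupType)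
    (V : vectType R) (rho : G -> 'End(V)) : Prop :=
  IsContinuousRepresentation {
  repr_one : rho 1%g = \1%VF;
  repr_mul : forall g h, rho (g * h)%g = (rho g \o rho h)%VF;
  repr_continuous : continuous (rho : G -> fdtop 'End(V))
}.

Definition W0 (R : realType) (G : topologicalGroupType) (H : groupClosed G) :
  set (G -> R) :=
  [set tau | [/\ continuous tau,
                 forall g h, tau (g * h)%g = tau g + tau h
               & forall h, h \in H -> tau h = 0]].

Definition dual (R : realType) (E : vectType R) := 'Hom(E, R^o).

Section Method.
Context {R : realType} {G : topologicalGroupType} {H : groupClosed G}.
Context {V : vectType R}.
Variables (rho : G -> 'End(V)) (v0 : V).
Variable nu : {measure set (borel (coset_space H)) -> \bar R}.
Implicit Types theta : dual V * (G -> R).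

(* The functions gH |-> rho(g) v0 and gH |-> tau(g), evaluated at the chosen
   representative; see [orbit_map_pi] and [char_map_pi]. *)
Definition orbit_map (x : coset_space H) : V := rho (repr x) v0.
Definition char_map (tau : G -> R) (x : coset_space H) : R := tau (repr x).

Lemma repr_pi_coset (g : G) :
  exists2 h, h \in H & repr (\pi_(coset_space H) g) = (g * h)%g.
Proof.
exists (g^-1 * repr (\pi_(coset_space H) g))%g; last by rewrite mulVKg.
have : repr (\pi_(coset_space H) g) = g %[mod {eq_quot left_coset_rel H}].
  exact: reprK.
by move/esym/eqquotP.
Qed.

Lemma orbit_map_pi (g : G) : is_continuous_representation rho ->
  (forall h, h \in H -> rho h v0 = v0) ->
  orbit_map (\pi_(coset_space H) g) = rho g v0.
Proof.
move=> [_ rhoM _] fixv0; rewrite /orbit_map.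
by have [h hH ->] := repr_pi_coset g; rewrite rhoM lfunE /= fixv0.
Qed.

Lemma char_map_pi (tau : G -> R) (g : G) : W0 H tau ->
  char_map tau (\pi_(coset_space H) g) = tau g.
Proof.
move=> [_ tauM tau0]; rewrite /char_map.
by have [h hH ->] := repr_pi_coset g; rewrite tauM (tau0 h) ?addr0.
Qed.

Definition ptilde theta (A : set (borel (coset_space H))) : \bar R :=
  (\int[nu]_(x in A)
     (expR (- (theta.1 (orbit_map x) : R) + char_map theta.2 x))%:E)%E.

Definition Theta : set (dual V * (G -> R)) :=
  [set theta | W0 H theta.2 /\ (ptilde theta [set: _] < +oo)%E].

Definition norm_const theta : \bar R := ((ptilde theta [set: _])^-1)%E.

(* Measures are compared on Borel sets only: the values of a measure of the
   library outside its sigma-algebra are irrelevant. *)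
Definition is_ptheta theta (p : {measure set (borel (coset_space H)) -> \bar R}) :
  Prop :=
  forall A : set (borel (coset_space H)), measurable A ->
    p A = (norm_const theta * ptilde theta A)%E.

Definition method_family :
  set {measure set (borel (coset_space H)) -> \bar R} :=
  [set p | exists2 theta, Theta theta & is_ptheta theta p].

End Method.

Definition is_exponential_family (R : realType) (X : ptopologicalType)
    (P : set {measure set (borel X) -> \bar R}) : Prop :=
  [/\ P !=set0,
      forall p, P p -> is_radon p /\ p [set: borel X] = 1%E
    & exists (mu : {measure set (borel X) -> \bar R}) (E : vectType R)
             (T : X -> E),
      [/\ is_radon mu,
          continuous (T : X -> fdtop E)
        & forall p, P p -> exists eta : dual E,
          let c := ((\int[mu]_x (expR (- (eta (T x) : R)))%:E)^-1)%E in
          forall A : set (borel X), measurable A ->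
            p A = (c * \int[mu]_(x in A) (expR (- (eta (T x) : R)))%:E)%E]].

(* Main.v *)
(** Take [nu] itself as reference measure and, as statistic, the orbit map
    [gH |-> rho(g) v0] together with a finite spanning family of [W0 G H]; what
    has to be proved is that [W0 G H] is finite dimensional and that each
    [p_theta] is a Radon probability measure.

    Finite dimension needs no Lie algebra.  Let [K] be a compact neighbourhood
    of 1 in [G] and [W] a neighbourhood of 1 with [w * w] in [K] for [w] in
    [W]; cover [K] by finitely many translates [g_i W].  If a continuous
    character [tau] vanishes at all the [g_i], then [k = g_i w] gives
    [tau k = tau w = tau (w * w) / 2], so the maximum of [|tau|] on [K] is at
    most half of itself and [tau = 0] on [K].  Then [tau] is locally constant,
    hence takes finitely many values when [G] has finitely many components,
    hence is 0.  So evaluation at the [g_i] is injective on [W0 G H].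

    For the Radon property: [U] being open and [f > 0] the continuous density,
    the part of [U] where [1/n < f < n] is open, has finite [nu]-measure and
    almost exhausts [U], and the inner regularity of [nu] on it passes to
    [f nu].  A finite Borel measure on a Hausdorff space which is inner regular
    on open sets is outer regular on Borel sets. *)
Require Import Defs.
From HB Require Import structures.
From mathcomp Require Import all_boot all_order all_algebra.
From mathcomp Require Import all_classical all_reals all_analysis.
From mathcomp Require Import finmap lra measurable_realfun.

Set Implicit Arguments.
Unset Strict Implicit.
Unset Printing Implicit Defensive.

Import Order.TTheory GRing.Theory Num.Theory.
Import numFieldNormedType.Exports.

Local Open Scope classical_set_scope.
Local Open Scope ring_scope.
Local Open Scope quotient_scope.

(** * Local compactness of Lie groups *)

Lemma rV_nbhs_compact (R : realType) (n : nat) (y : 'rV[R]_n)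
    (U : set 'rV[R]_n) : nbhs y U ->
  exists B : set 'rV[R]_n, [/\ nbhs y B, compact B & B `<=` U].
Proof.
move=> /nbhs_closedballP[r rU]; exists (closed_ball y r%:num); split=> //.
  by apply/nbhs_closedballP; exists r.
apply: bounded_closed_compact; last exact: closed_ball_closed.
exists (`|y| + r%:num); split=> // M ltM z.
rewrite closed_ballE// => zB; apply/ltW/(le_lt_trans _ ltM).
by rewrite -[z](subKr y) (le_trans (ler_normB _ _))// lerD2l.
Qed.

(** A compact neighbourhood inside the image of a chart is carried back to the group by the inverse
    chart, whose continuity there preserves compactness. *)
Lemma lie_group_locally_compact (R : realType) (G : lieGroupType R) (x : G) :
  exists2 K : set G, compact K & nbhs x K.
Proof.
have [Ach Acov _] := @lie_smooth_atlas R G.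
have [c Ac cx] := Acov x.
have [cO iO cK cC iC] := Ach c Ac.
have [B [yB Bc BI]] :
    exists B, [/\ nbhs (chart_map c x) B, compact B & B `<=` chart_img c].
  by apply/rV_nbhs_compact/open_nbhs_nbhs; split=> //; exists x.
exists (chart_inv c @` B).
  apply: continuous_compact => //.
  by apply: continuous_in_subspaceT => y /set_mem/BI/iC.
have : nbhs x (chart_dom c `&` (chart_map c @^-1` B)).
  by apply: filterI; [exact: open_nbhs_nbhs|exact: cC].
by apply: filterS => z [dz bz]; exists (chart_map c z) => //; exact: cK.
Qed.

(** * Continuous characters and their evaluation at finitely many points *)

Section ContinuousCharacters.
Context {R : realType} {G : topologicalGroupType}.
Implicit Types (tau : G -> R) (K : set G).

Lemma char_one tau : (forall g h, tau (g * h)%g = tau g + tau h) ->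
  tau 1%g = 0.
Proof.
by move=> tauM; apply: (@addrI _ (tau 1%g)); rewrite -tauM mulg1 addr0.
Qed.

Lemma char_inv tau g : (forall g h, tau (g * h)%g = tau g + tau h) ->
  tau g^-1%g = - tau g.
Proof.
by move=> tauM; apply/eqP; rewrite -addr_eq0 -tauM mulVg char_one.
Qed.

Lemma cvgMg {T : Type} (F : set_system T) (f g : T -> G) (a b : G) :
  Filter F -> f @ F --> a -> g @ F --> b ->
  (fun x => f x * g x)%g @ F --> (a * b)%g.
Proof.
move=> FF fa gb.
apply: (@cvg_comp _ _ _ (fun x => (f x, g x)) (fun z => z.1 * z.2)%g
  _ (nbhs (a, b))).
  exact: cvg_pair.
exact: (@topgroup_mul_continuous G (a, b)).
Qed.

Lemma mulg_continuous_r (g : G) : continuous (fun x : G => (x * g)%g).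
Proof. by move=> x; apply: cvgMg; [exact: cvg_id|exact: cvg_cst]. Qed.

Lemma mulg_continuous_l (g : G) : continuous (fun x : G => (g * x)%g).
Proof. by move=> x; apply: cvgMg; [exact: cvg_cst|exact: cvg_id]. Qed.

(** If [tau g] were nonzero, the powers of [g] would give infinitely many values [tau g *+ n],
    whereas local constancy leaves one value per component. *)
Lemma char_eq0_finitely_many_components tau K :
  finitely_many_components G -> nbhs 1%g K ->
  (forall g h, tau (g * h)%g = tau g + tau h) ->
  (forall k, K k -> tau k = 0) -> forall g, tau g = 0.
Proof.
move=> Gfin K1 tauM tauK.
have loc (g : G) : \forall h \near g, tau h = tau g.
  have : nbhs g ((fun x => g^-1 * x)%g @^-1` K).
    by apply: mulg_continuous_l; rewrite mulVg.
  apply: filterS => h /= /tauK; rewrite tauM char_inv//.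
  by rewrite addrC => /eqP; rewrite subr_eq0 => /eqP.
(* [A] is arbitrary: level sets and their complements are both open, so each level set is clopen. *)
have levO (A : set R) : open (tau @^-1` A).
  by rewrite openE => g Ag; apply: filterS (loc g) => h /= hg; rewrite /= hg.
have comp (g h : G) : connected_component setT h g -> tau g = tau h.
  move=> gC.
  pose C := connected_component setT h; pose L := tau @^-1` [set tau h].
  suff [] : (C `&` L) g by [].
  rewrite (@component_connected G setT h (C `&` L))//.
  - by exists h; split=> //; exact: connected_component_refl.
  - by exists L => //; exact: levO.
  - by exists L => //; rewrite -openC preimage_setC; exact: levO.
have rfin : finite_set (range tau).
  (* A component is sent to the value of [tau] at a point chosen in it; components are nonempty, so
     the default [1%g] never serves. *)
  apply: (@sub_finite_set _ _
    ((fun C => tau (xget 1%g C)) @` range (connected_component [set: G]))).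
    move=> _ [g _ <-]; exists (connected_component setT g); first by exists g.
    apply: comp; apply: xgetPex; exists g.
    exact: connected_component_refl.
  exact: finite_image.
move=> g; apply/eqP/negPn/negP => tg0.
apply: infinite_nat.
apply: (@sub_finite_set _ _ ((fun n : nat => tau (g ^+ n)%g) @^-1` range tau)).
  by move=> n _ /=; exists (g ^+ n)%g.
have tauX n : tau (g ^+ n)%g = tau g *+ n.
  by elim: n => [|n IH]; [rewrite expg0 char_one|rewrite expgS tauM IH mulrS].
apply: finite_preimage rfin => m n _ _.
rewrite !tauX -!(mulr_natl (tau g)) => /(mulIf tg0)/eqP.
by rewrite eqr_nat => /eqP.
Qed.

Lemma finite_evaluation_separates_characters K :
  finitely_many_components G -> compact K -> nbhs 1%g K ->
  exists (N : nat) (g : 'I_N -> G), forall tau, continuous tau ->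
    (forall x y, tau (x * y)%g = tau x + tau y) ->
    (forall i, tau (g i) = 0) -> forall x, tau x = 0.
Proof.
move=> Gfin Kc K1.
pose W : set G := ((fun x => x * x)%g @^-1` K)^°.
have W1 : nbhs 1%g W.
  apply: nbhs_interior.
  have sqC : {for 1%g, continuous (fun x : G => (x * x)%g)}.
    by apply: cvgMg; exact: cvg_id.
  by apply: sqC; rewrite mulg1.
(* [compact_cover] is stated for pointed spaces only. *)
pose Gp := HB.pack_for ptopologicalType G (isPointed.Build G 1%g).
have /(_ G K (fun g => (fun x => g^-1 * x)%g @^-1` W)) : @cover_compact Gp K.
  by rewrite -compact_cover.
case=> [g _||D DK Kcov].
- apply: open_comp; last exact: open_interior.
  by move=> x _; exact: mulg_continuous_l.
- move=> g Kg; exists g => //=; rewrite mulVg; exact: nbhs_singleton.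
(* The index stays below the size of the list, so the default [1%g] of [nth] is never returned. *)
exists (size (enum_fset D)), (fun i => nth 1%g (enum_fset D) i).
move=> tau tauC tauM tau0.
apply: (char_eq0_finitely_many_components Gfin K1 tauM).
have K0 : K !=set0 by exists 1%g; exact: nbhs_singleton.
have [|k0 Kk0 k0max] := @compact_EVT_max G R (fun x => `|tau x|) K K0 Kc.
  apply: continuous_subspaceT => x; apply: cvg_norm; exact: tauC.
suff k00 : `|tau k0| <= 0.
  move=> k Kk; apply/eqP; rewrite -normr_le0.
  by apply: le_trans k00; apply: k0max; exact: mem_set.
(* Put [w = g^-1 * k0], which lies in [W]. Then [w * w] is in [K] and [tau w = tau k0], so
   maximality at [k0] reads [2 * |tau k0| <= |tau k0|]. *)
have /Kcov[g /= gD] := set_mem Kk0.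
move=> /interior_subset/mem_set/k0max /=.
rewrite !tauM char_inv//.
have -> : tau g = 0.
  have gs : (index g (enum_fset D) < size (enum_fset D))%N by rewrite index_mem.
  by have := tau0 (Ordinal gs); rewrite /= nth_index.
rewrite oppr0 add0r -mulr2n normrMn mulr2n; lra.
Qed.

End ContinuousCharacters.

(* A family in [S] whose evaluation matrix at the points [g i] has maximal rank
   spans [S]. *)
Lemma functions_finite_span (F : fieldType) (X : Type) (N : nat)
    (g : 'I_N -> X) (S : set (X -> F)) :
  (forall a f h, S f -> S h -> S (fun x => a * f x + h x)) ->
  (forall f, S f -> (forall i, f (g i) = 0) -> forall x, f x = 0) ->
  exists m (t : 'I_m -> X -> F), (forall i, S (t i)) /\
    forall f, S f -> exists c : 'I_m -> F, forall x, f x = \sum_i c i * t i x.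
Proof.
move=> Slin Sinj.
pose ev m (t : 'I_m -> X -> F) := \matrix_(i < m, j < N) t i (g j).
pose P k := `[< exists m (t : 'I_m -> X -> F),
  (forall i, S (t i)) /\ \rank (ev m t) = k >].
have P0 : exists k, P k.
  exists 0; apply/asboolP; exists 0, (fun i _ => 0); split=> [[]//|].
  by apply/eqP; rewrite -leqn0 rank_leq_row.
have PN k : P k -> (k <= N)%N.
  by move=> /asboolP[m [t [_ <-]]]; exact: rank_leq_col.
case: (ex_maxnP P0 PN) => _ /asboolP[m [t [St <-]]] tmax.
exists m, t; split=> // f Sf.
pose t' (i : 'I_(1 + m)) := if fintype.split i is inr j then t j else f.
have St' i : S (t' i) by rewrite /t'; case: splitP.
have t'E : ev (1 + m)%N t' = col_mx (\row_j f (g j)) (ev m t).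
  apply/matrixP => i j; rewrite !mxE /t'.
  by case: splitP => k _; rewrite !mxE.
(* Adding [f] to [t] cannot raise the maximal rank, so the evaluation row of [f] is a combination of
   the rows of [t]. *)
have : (\rank (ev (1 + m)%N t') <= \rank (ev m t))%N.
  by apply: tmax; apply/asboolP; exists (1 + m)%N, t'.
have tt' : (ev m t <= ev (1 + m)%N t')%MS.
  by rewrite t'E -addsmxE addsmxSr.
rewrite (geq_leqif (mxrank_leqif_sup tt')) t'E col_mx_sub => /andP[+ _].
move=> /submxP[c fE]; exists (c 0).
have Scomb : S (fun x => f x - \sum_i c 0 i * t i x).
  (* The terms are subtracted one at a time, starting from [f] itself, to stay within what [Slin]
     provides. *)
  elim: (index_enum _) => [|i r IH].
    by under eq_fun do rewrite big_nil subr0.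
  have := Slin (- c 0 i) (t i) _ (St i) IH; congr S; apply/funext => x.
  by rewrite big_cons opprD mulNr addrCA.
move=> x; apply/eqP; rewrite -subr_eq0; apply/eqP.
apply: (Sinj _ Scomb) => j; apply/eqP; rewrite subr_eq0; apply/eqP.
move/matrixP: fE => /(_ 0 j); rewrite !mxE => ->.
by apply: eq_bigr => i _; rewrite mxE.
Qed.

(** * Continuity of maps into finite-dimensional vector spaces *)

Section VectorSpaceTopology.
Context {R : realType} {X : topologicalType}.

Lemma continuous_sumr (I : Type) (r : seq I) (F : I -> X -> R) :
  (forall i, continuous (F i)) -> continuous (fun x => \sum_(i <- r) F i x).
Proof.
move=> Fc; elim: r => [|i r IH] x.
  by under eq_fun do rewrite big_nil; exact: cvg_cst.
by under eq_fun do rewrite big_cons; exact: (cvgD (Fc i x) (IH x)).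
Qed.

(** The topology of [fdtop] is initial for the coordinates, and each coordinate is itself a
    functional, so functionals detect continuity. *)
Lemma continuous_fdtop (E : vectType R) (T : X -> E) :
  (forall phi : dual E, continuous (phi \o T : X -> R)) ->
  continuous (T : X -> fdtop E).
Proof.
move=> phiT; apply: continuous_comp_initial => x.
move=> A [P Pnbhs PA]; apply: filterS PA _.
(* Packing both indices into one finite type lets the finitely many neighbourhoods be intersected at
   once. *)
suff : \forall y \near x, forall ij : 'I_1 * 'I_(\dim {:E}),
    P ij.1 ij.2 (passmx.rVof (vbasis fullv) (T y) ij.1 ij.2).
  by move=> Q; apply: filterS Q => y Py i j; exact: (Py (i, j)).
apply: (@filter_forall _ _
  (fun ij y => P ij.1 ij.2 (passmx.rVof (vbasis fullv) (T y) ij.1 ij.2))).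
move=> [i j] /=.
have Q : nbhs x ((linfun (coord (vbasis {:E}) j) \o T) @^-1` P i j).
  by apply: phiT; have := Pnbhs i j; rewrite /= mxE lfunE.
by apply: filterS Q => y /=; rewrite lfunE mxE.
Qed.

(** Every functional is a linear combination of the coordinates, which are continuous on [fdtop] by
    construction. *)
Lemma continuous_dual_comp (E : vectType R) (T : X -> E) (phi : dual E) :
  continuous (T : X -> fdtop E) -> continuous (phi \o T : X -> R).
Proof.
move=> Tc.
have -> : (phi \o T : X -> R) = fun x =>
  \sum_i passmx.rVof (vbasis fullv) (T x) 0 i * (phi (vbasis fullv)`_i : R).
  apply/funext => x /=.
  rewrite {1}(coord_vbasis (memvf (T x))) linear_sum.
  by apply: eq_bigr => i _; rewrite linearZ mxE.
apply: continuous_sumr => i x; apply: cvgM; last exact: cvg_cst.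
apply: (@cvg_comp _ _ _ (passmx.rVof (vbasis fullv) \o T) (fun M => M 0 i));
  last first.
  exact: coord_continuous.
apply: cvg_comp; first exact: Tc.
exact: initial_continuous.
Qed.

End VectorSpaceTopology.

(** * Densities and regularity of Borel measures *)

Section BorelMeasures.
Context {R : realType} {X : ptopologicalType}.
Implicit Types (mu nu : {measure set (borel X) -> \bar R}).

Lemma open_borel (U : set X) : open U -> measurable (U : set (borel X)).
Proof. exact: sub_sigma_algebra. Qed.

Lemma closed_borel (F : set X) : closed F -> measurable (F : set (borel X)).
Proof.
move=> Fc; rewrite -[F]setCK; apply: measurableC; apply: open_borel.
exact: closed_openC.
Qed.

Lemma continuous_borel (f : X -> R) : continuous f ->
  measurable_fun [set: borel X] (f : borel X -> R).
Proof.
move=> /continuousP fc.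
apply: (measurability _ (measurable_realfun.RGenOpens.measurableE R)).
move=> _ [_ [a [b ->] <-]]; rewrite setTI; apply: open_borel.
exact/fc/interval_open.
Qed.

Section Density.
Variables (nu : {measure set (borel X) -> \bar R}) (f : X -> R).
Hypotheses (fc : continuous f) (f0 : forall x, 0 <= f x).

Definition density_measure (A : set (borel X)) : \bar R :=
  (\int[nu]_(x in A) (f x)%:E)%E.

Let density_measurable (A : set (borel X)) :
  measurable A -> measurable_fun A (EFin \o (f : borel X -> R)).
Proof.
move=> mA; apply: (measurable_funS measurableT) => //.
by apply/measurable_EFinP; exact: continuous_borel.
Qed.

Let density0 : density_measure set0 = 0%E.
Proof. exact: integral_set0. Qed.

Let density_ge0 A : (0 <= density_measure A)%E.
Proof. by apply: integral_ge0 => x _; rewrite lee_fin. Qed.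

Let density_sigma_additive : semi_sigma_additive density_measure.
Proof.
move=> A mA tA mUA; rewrite /density_measure ge0_integral_bigcup//.
- apply: is_cvg_ereal_nneg_natsum_cond => n _ _; exact: density_ge0.
- exact: density_measurable.
- by move=> x _; rewrite lee_fin.
Qed.

Lemma ex_density_measure :
  exists mu, forall A : set (borel X), mu A = density_measure A.
Proof.
pose m := isMeasure.Build _ _ _ density_measure density0 density_ge0
  density_sigma_additive.
by exists (HB.pack_for {measure set (borel X) -> \bar R} density_measure m).
Qed.

Lemma density_measureZ (z : R) (A : set (borel X)) : 0 <= z -> measurable A ->
  (z%:E * density_measure A = \int[nu]_(x in A) (z * f x)%:E)%E.
Proof.
move=> z0 mA; rewrite /density_measure -ge0_integralZl//.
  exact: density_measurable.
by move=> x _; rewrite lee_fin.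
Qed.

(** A zero integral would force [f] to vanish outside a null set; as [f] vanishes nowhere, that null
    set would be the whole space. *)
Lemma density_measure_gt0 : (forall x, 0 < f x) ->
  nu [set: borel X] != 0%E -> (0 < density_measure [set: borel X])%E.
Proof.
move=> fgt0; apply: contraNT; rewrite -leNgt => p0.
have : (\int[nu]_x `|(EFin \o (f : borel X -> R)) x|)%E = 0%E.
  apply/eqP; rewrite eq_le integral_ge0 ?andbT// (le_trans _ p0)//.
  rewrite le_eqVlt; apply/orP; left; apply/eqP; apply: eq_integral => x _.
  by rewrite /= ger0_norm.
move/ae_eq_integral_abs => /(_ measurableT (density_measurable measurableT)).
move=> [N [mN N0 NP]].
rewrite -measure_le0 -N0; apply: le_measure; [exact: mem_set|exact: mem_set|].
by move=> x _; apply: NP => /= /(_ I) [] /eqP; rewrite gt_eqF.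
Qed.

End Density.

Section Regularity.
Variable mu : {measure set (borel X) -> \bar R}.
Hypotheses (X_hausdorff : hausdorff_space X)
  (mufin : (mu [set: borel X] < +oo)%E).

Let muD (A B : set (borel X)) : measurable A -> measurable B ->
  A `<=` B -> (mu B = mu A + mu (B `\` A))%E.
Proof.
move=> mA mB AB; rewrite -measureU//; [|exact: measurableD|].
  by rewrite setDUK.
by apply/seteqP; split=> x // [? []].
Qed.

Let mono (A B : set (borel X)) : measurable A -> measurable B ->
  A `<=` B -> (mu A <= mu B)%E.
Proof. by move=> mA mB AB; apply: le_measure => //; exact: mem_set. Qed.

Let lt_fin (A : set (borel X)) : measurable A -> (mu A < +oo)%E.
Proof.
by move=> mA; apply: le_lt_trans mufin; exact: mono.
Qed.

(** The inner sets are closed rather than compact so that complements exchange inner and outer sets;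
    this makes the class a sigma-algebra. *)
Let approx (B : set (borel X)) := forall e : R, 0 < e ->
  exists (F U : set X), [/\ closed F, open U, F `<=` B, B `<=` U &
    (mu (U `\` F) < e%:E)%E].

Hypothesis inner : forall (U : set X) (e : R), open U -> 0 < e ->
  exists K : set X, [/\ compact K, K `<=` U & (mu (U `\` K) < e%:E)%E].

Let approx_sigma_algebra : sigma_algebra [set: borel X] approx.
Proof.
split.
- move=> e e0; exists set0, set0; split=> //; first exact: closed0.
    exact: open0.
  by rewrite setDv measure0 lte_fin.
- move=> B Bapx e /Bapx[F [U [Fc Uo FB BU UF]]].
  exists (~` U), (~` F); split.
  + exact: open_closedC.
  + exact: closed_openC.
  + by rewrite setTD; exact: subsetC.
  + by rewrite setTD; exact: subsetC.
  + by rewrite setDE setCK setIC -setDE.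
- move=> B Bapx e e0.
  have e20 : 0 < e / 2 by rewrite divr_gt0.
  (* The tolerances sum to [e / 2], strictly below [e], which leaves room to pass from a limit to a
     finite stage. *)
  have /choice[FU FUP] : forall n, exists FU : set X * set X,
      [/\ closed FU.1, open FU.2, FU.1 `<=` B n, B n `<=` FU.2 &
          (mu (FU.2 `\` FU.1) < (e / 2 / (2 ^ n.+1)%:R)%:E)%E].
    move=> n; have [|F [U H]] := Bapx n (e / 2 / (2 ^ n.+1)%:R).
      by rewrite divr_gt0// ltr0n expn_gt0.
    by exists (F, U).
  pose U := \bigcup_n (FU n).2.
  have Uo : open U by apply: bigcup_open => n _; case: (FUP n).
  (* An infinite union of closed sets need not be closed, so it is truncated at [N]; continuity from
     above, available since [mu] is finite, will select [N]. *)
  pose F N := \bigcup_(n < N) (FU n).1.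
  have Fc N : closed (F N).
    by apply: closed_bigcup => [|n _]; [exact: finite_II|case: (FUP n)].
  have mUF N : measurable ((U `\` F N) : set (borel X)).
    by apply: measurableD; [exact: open_borel|exact: closed_borel].
  have capUF : \bigcap_N (U `\` F N) `<=` \bigcup_n ((FU n).2 `\` (FU n).1).
    move=> x xUF; have [[n _ Ux] _] := xUF 0 I; exists n => //; split=> // Fx.
    (* [F N] involves only the indices below [N], so stage [n.+1] is needed to include the set of
       index [n]. *)
    by have [_] := xUF n.+1 I; apply; exists n => /=.
  have mcap : measurable (\bigcap_N (U `\` F N) : set (borel X)).
    exact: bigcap_measurable.
  have capUFe : (mu (\bigcap_N (U `\` F N)) < e%:E)%E.
    apply: (@le_lt_trans _ _ (e / 2)%:E); last by rewrite lte_fin; lra.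
    apply: le_trans (epsilon_trick0 xpredT (ltW e20)).
    apply: (@le_trans _ _ (\sum_(0 <= n <oo) mu ((FU n).2 `\` (FU n).1))%E).
      apply: measure_sigma_subadditive => // n; have [? ? _ _ _] := FUP n.
      by apply: measurableD; [exact: open_borel|exact: closed_borel].
    apply: lee_nneseries => [n _ _|n _]; first exact: measure_ge0.
    by have [_ _ _ _ /ltW] := FUP n.
  have : mu (U `\` F n) @[n --> \oo] --> mu (\bigcap_n (U `\` F n)).
    apply: nonincreasing_cvg_mu => //; first exact: lt_fin.
    move=> n m nm; apply/subsetPset => x [Ux nF]; split=> // -[k /= kn kF].
    by apply: nF; exists k => //=; exact: leq_trans nm.
  move=> /(_ [set y | (y < e%:E)%E] _)[|N _ /(_ N (leqnn N)) /= UFe].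
    by apply: open_nbhs_nbhs; split=> //; exact: open_ereal_lt_ereal.
  exists (F N), U; split=> //.
    by move=> x [n _ Fx]; exists n => //; have [_ _ + _ _] := FUP n; exact.
  by move=> x [n _ Bx]; exists n => //; have [_ _ _ + _] := FUP n; exact.
Qed.

(** An open set is its own outer approximation; the compact set inside it is closed because the
    space is Hausdorff. *)
Let borel_approx (B : set (borel X)) : measurable B -> approx B.
Proof.
apply: smallest_sub => // U Uo e e0.
have [K [Kc KU ?]] := inner Uo e0; exists K, U; split=> //.
exact: compact_closed.
Qed.

Lemma radon_of_open_inner_regular : is_radon mu.
Proof.
split.
- by move=> K /(compact_closed X_hausdorff)/closed_borel/lt_fin.
- move=> B mB; apply/eqP; rewrite eq_le; apply/andP; split.
    apply: le_ereal_inf_tmp => _ [U [Uo BU] <-].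
    by apply: mono => //; exact: open_borel.
  apply/lee_addgt0Pr => e e0.
  have [F [U [Fc Uo FB BU UFe]]] := borel_approx mB e0.
  have mU := open_borel Uo; have mF := closed_borel Fc.
  apply: (@le_trans _ _ (mu U)); first by apply: ereal_inf_lbound; exists U.
  rewrite (muD mB mU BU) leeD2l// (le_trans _ (ltW UFe))//.
  apply: mono; [exact: measurableD|exact: measurableD|].
  exact: setDS.
- move=> U Uo; apply/eqP; rewrite eq_le; apply/andP; split; last first.
    apply: ge_ereal_sup => _ [K [Kc KU] <-].
    apply: mono => //; last exact: open_borel.
    by apply: closed_borel; exact: compact_closed X_hausdorff _.
  apply/lee_addgt0Pr => e e0.
  have [K [Kc KU UKe]] := inner Uo e0.
  have mU := open_borel Uo.
  have mK := closed_borel (compact_closed X_hausdorff Kc).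
  rewrite (muD mK mU KU) leeD ?(ltW UKe)//.
  by apply: ereal_sup_ubound; exists K.
Qed.

End Regularity.
End BorelMeasures.

(** * Topology of the coset space *)

(** The preimage of the image of [U] is the union of the right translates of [U] by elements of [H],
    each of which is open. *)
Lemma pi_coset_open (G : topologicalGroupType) (H : groupClosed G) (U : set G) :
  open U -> open (\pi_(coset_space H) @` U).
Proof.
move=> Uo.
suff -> : open (\pi_(coset_space H) @` U) =
    open (\bigcup_(h in [set h | h \in H]) (fun x : G => x * h^-1)%g @^-1` U).
  apply: bigcup_open => h _.
  move/continuousP: (@mulg_continuous_r G h^-1%g); exact.
rewrite {1}/open /= /quotient_open; congr open.
apply/seteqP; split=> [x [u Uu /esym/eqmodP ux]|x [h hH Uxh]].
  exists (u^-1 * x)%g => /=.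
    by rewrite -gpredV invgM invgK.
  by rewrite invgM invgK mulVKg.
exists (x * h^-1)%g => //; apply/eqmodP.
by rewrite /= /left_coset_rel invgM invgK mulgVK.
Qed.

(** If [a^-1 * b] avoids the closed set [H], so does [x^-1 * y] for [x] near [a] and [y] near [b];
    the open projection turns these neighbourhoods into disjoint open sets. *)
Lemma coset_space_hausdorff (G : topologicalGroupType) (H : groupClosed G) :
  closed [set h : G | h \in H] -> hausdorff_space (coset_space H).
Proof.
move=> Hc; rewrite open_hausdorff => x y.
rewrite -(reprK x) -(reprK y); move: (repr x) (repr y) => a b ab.
have abH : (~` [set h : G | h \in H]) (a^-1 * b)%g.
  move=> abH; move/eqP: ab; apply; apply/eqmodP; exact: abH.
have : nbhs (a, b)
    ((fun z : G * G => z.1^-1 * z.2)%g @^-1` ~` [set h : G | h \in H]).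
  apply: (@cvgMg G _ (nbhs (a, b)) (fun z => z.1^-1%g) (fun z => z.2)
    a^-1%g b).
  - apply: (@cvg_comp _ _ _ fst (fun x : G => x^-1%g) _ (nbhs a)).
      exact: (@cvg_fst _ _ (nbhs a) (nbhs b) _).
    exact: (@topgroup_inv_continuous G a).
  - exact: (@cvg_snd _ _ (nbhs a) (nbhs b) _).
  - by apply: open_nbhs_nbhs; split=> //; exact: closed_openC.
move=> [[A B] /= [/nbhs_interior Aa /nbhs_interior Bb] AB].
exists (\pi_(coset_space H) @` A°, \pi_(coset_space H) @` B°); split => /=.
- by apply: mem_set; exists a => //; exact: nbhs_singleton.
- by apply: mem_set; exists b => //; exact: nbhs_singleton.
- by apply: pi_coset_open; exact: open_interior.
- by apply: pi_coset_open; exact: open_interior.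
apply/eqP; rewrite -subset0 => _ [[a' /interior_subset Aa' <-]].
move=> [b' /interior_subset Bb' /esym/eqmodP abH'].
by apply: (AB (a', b')).
Qed.

(** * The Radon property for measures with a continuous density *)

Lemma radon_density (R : realType) (X : ptopologicalType)
    (nu mu : {measure set (borel X) -> \bar R}) (f : X -> R) :
  hausdorff_space X -> is_radon nu -> continuous f -> (forall x, 0 < f x) ->
  (forall A : set (borel X), measurable A ->
    mu A = (\int[nu]_(x in A) (f x)%:E)%E) ->
  (mu [set: borel X] < +oo)%E -> is_radon mu.
Proof.
move=> X_hausdorff [_ _ nu_inner] fc f0 muE mufin.
apply: radon_of_open_inner_regular => // U e Uo e0.
have e20 : 0 < e / 2 by rewrite divr_gt0.
have mono (m : {measure set (borel X) -> \bar R}) (A B : set (borel X)) :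
  measurable A -> measurable B -> A `<=` B -> (m A <= m B)%E.
  by move=> mA mB AB; apply: le_measure => //; exact: mem_set.
have mf (A : set (borel X)) :
  measurable A -> measurable_fun A (EFin \o (f : borel X -> R)).
  move=> mA; apply: (measurable_funS measurableT) => //.
  by apply/measurable_EFinP; exact: continuous_borel.
(* The lower bound on [f] will make [nu] finite on the part of [U] in [V n]; the upper bound will
   make sets of small [nu]-measure small for [mu]. *)
pose V n : set X := f @^-1` `]n.+1%:R^-1, n.+1%:R[.
have Vo n : open (V n) by move/continuousP : fc; apply; exact: interval_open.
have UVo n : open (U `&` V n) by exact: openI.
have mU := open_borel Uo.
have mV n : measurable (V n : set (borel X)) by exact: open_borel.
have mUV n : measurable (U `\` V n : set (borel X)) by exact: measurableD.
have capUV : \bigcap_n (U `\` V n) = set0.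
  apply/seteqP; split=> // x UVx.
  pose n := maxn (Num.bound (f x)) (Num.bound (f x)^-1).
  have [_] := UVx n I; apply; rewrite /V /= in_itv /=; apply/andP; split.
    rewrite invf_plt ?posrE//; apply: lt_le_trans (archi_boundP _) _.
      by rewrite invr_ge0 ltW.
    by rewrite ler_nat ltnW// ltnS leq_maxr.
  apply: lt_le_trans (archi_boundP (ltW (f0 x))) _.
  by rewrite ler_nat ltnW// ltnS leq_maxl.
have : mu (U `\` V n) @[n --> \oo] --> mu (\bigcap_n (U `\` V n)).
  apply: nonincreasing_cvg_mu => //.
  - by apply: le_lt_trans mufin; exact: mono.
  - by rewrite capUV.
  move=> n m nm; apply/subsetPset => x [Ux nV]; split=> // Vx; apply: nV.
  move: Vx; rewrite /V /= !in_itv /= => /andP[nf fn]; apply/andP; split.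
    by apply: le_lt_trans nf; rewrite lef_pV2 ?posrE// ler_nat.
  by apply: lt_le_trans fn _; rewrite ler_nat.
rewrite capUV measure0.
move=> /(_ [set y | (y < (e / 2)%:E)%E] _)[|n _ /(_ n (leqnn n)) /= UVe].
  apply: open_nbhs_nbhs; split; first exact: open_ereal_lt_ereal.
  by rewrite /= lte_fin.
have mUIV : measurable (U `&` V n : set (borel X)) by exact: open_borel.
(* Finiteness passes from [mu] back to [nu] through the bound [1 / n.+1 < f]; it is required to
   approach the supremum in inner regularity. *)
have nu_fin : (nu (U `&` V n) < +oo)%E.
  have := mono mu _ _ mUIV measurableT (@subsetT _ _).
  move=> /le_lt_trans /(_ mufin).
  rewrite muE// => finUV.
  have : ((n.+1%:R^-1)%:E * nu (U `&` V n) < +oo)%E.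
    apply: le_lt_trans finUV; rewrite -integral_cst//.
    apply: (@ge0_le_integral _ _ _ nu _ mUIV (cst _)
      (EFin \o (f : borel X -> R))).
    - by move=> x _; rewrite lee_fin.
    - exact: measurable_cst.
    - exact: mf.
    - by move=> x [_]; rewrite /V /= in_itv /= lee_fin => /andP[/ltW].
  case: (nu _) (measure_ge0 nu (U `&` V n)) => [r _ _|_|//].
    by rewrite ltry.
  by rewrite gt0_muley// lte_fin invr_gt0.
(* As [f < n.+1] on [V n], a Borel subset of [V n] of [nu]-measure below [d] has [mu]-measure at
   most [e / 2]. *)
pose d := e / 2 / n.+1%:R.
have d0 : 0 < d by rewrite divr_gt0.
have := nu_inner _ (UVo n).
set S := (X in ereal_sup X) => supS.
have [|_ [K [Kc KUV] <-]] := @ub_ereal_sup_adherent _ S d d0.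
  by rewrite -supS ge0_fin_numE.
rewrite -supS => nuK.
have mK : measurable (K : set (borel X)).
  by apply: closed_borel; exact: compact_closed Kc.
exists K; split=> // [x /KUV[]//|].
have mUVK : measurable ((U `&` V n) `\` K : set (borel X)).
  exact: measurableD.
have : (nu ((U `&` V n) `\` K) < d%:E)%E.
  have -> : nu ((U `&` V n) `\` K) = (nu (U `&` V n) - nu K)%E.
    by rewrite measureD//; congr (_ - nu _)%E; exact: setIidr.
  have nuKfin : nu K \is a fin_num.
    by rewrite ge0_fin_numE//; apply: le_lt_trans nu_fin; exact: mono.
  by rewrite lteBlDr// addeC -lteBlDr.
move=> nud.
have muUVK : (mu ((U `&` V n) `\` K) <= (e / 2)%:E)%E.
  rewrite muE//.
  apply: (@le_trans _ _ ((n.+1%:R)%:E * nu ((U `&` V n) `\` K))%E).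
    rewrite -integral_cst//.
    apply: (@ge0_le_integral _ _ _ nu _ mUVK
      (EFin \o (f : borel X -> R)) (cst _)).
    - by move=> x _; rewrite lee_fin ltW.
    - exact: mf.
    - exact: measurable_cst.
    - by move=> x [[_]]; rewrite /V /= in_itv /= lee_fin => /andP[_ /ltW].
  apply: (@le_trans _ _ ((n.+1%:R)%:E * d%:E)%E).
    by rewrite lee_pmul2l// ?lte_fin// ltW.
  by rewrite -EFinM lee_fin /d mulrC divfK.
(* The first piece holds the extreme values of [f], the second what the compact set misses; each
   costs at most [e / 2]. *)
have -> : U `\` K = (U `\` V n) `|` ((U `&` V n) `\` K).
  apply/seteqP; split=> x.
    by move=> [Ux Kx]; have [Vx|Vx] := pselect (V n x); [right|left].
  by move=> [[Ux Vx]|[[Ux _] Kx]]; split=> // /KUV[_ /Vx].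
apply: (le_lt_trans (measureU2 _ _ _)) => //.
rewrite [e in (_ < e%:E)%E]splitr EFinD.
apply: lte_leD => //.
by rewrite ge0_fin_numE//; apply: le_lt_trans muUVK _; exact: ltry.
Qed.

(** * Linear functionals and finite dimension of [W0] *)

Lemma linear_dual (R : realType) (E : vectType R) (f : E -> R^o) :
  linear f -> exists phi : dual E, forall u, phi u = f u.
Proof.
move=> f_lin.
pose fL := HB.pack_for {linear E -> R^o} f
  (GRing.isLinear.Build _ _ _ _ f f_lin).
by exists (linfun fL) => u; rewrite lfunE.
Qed.

Lemma W0_finite_dimensional (R : realType) (G : lieGroupType R)
    (H : groupClosed G) : finitely_many_components G ->
  exists m (t : 'I_m -> G -> R), (forall i, W0 H (t i)) /\
    forall tau, W0 H tau ->
      exists c : 'I_m -> R, forall g, tau g = \sum_i c i * t i g.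
Proof.
move=> Gfin; have [K Kc K1] := lie_group_locally_compact (1%g : G).
have [N [g gP]] := finite_evaluation_separates_characters (R := R) Gfin Kc K1.
apply: (functions_finite_span (g := g)) =>
  [a f h [fc fM f0] [hc hM h0]|f [fc fM f0]].
  split=> [x|x y|x xH].
  - by apply: cvgD; [apply: cvgM; [exact: cvg_cst|exact: fc]|exact: hc].
  - by rewrite fM hM mulrDr addrACA.
  - by rewrite f0// h0// mulr0 addr0.
exact: gP.
Qed.

(** * Normalization and regularity of the measures of the family *)

Section Method.
Context {R : realType} {G : topologicalGroupType} {H : groupClosed G}.
Context {V : vectType R}.
Variables (rho : G -> 'End(V)) (v0 : V).
Variable nu : {measure set (borel (coset_space H)) -> \bar R}.
Hypotheses (rho_repr : is_continuous_representation rho)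
  (v0_fixed : forall h, h \in H -> rho h v0 = v0).

(** Lifted to [G], the map is [rho] followed by the functional sending [A] to [phi (A v0)] on
    endomorphisms; continuity then descends to the quotient. *)
Lemma dual_orbit_continuous (phi : dual V) :
  continuous ((fun x => phi (orbit_map rho v0 x)) : coset_space H -> R).
Proof.
apply/quotient_continuous.
pose ev (A : 'End(V)) : R^o := phi (A v0).
have ev_lin : linear ev by move=> a A B; rewrite /ev !lfunE /= lfunE /= linearP.
have [psi psiE] := linear_dual ev_lin.
have -> : (fun x => phi (orbit_map rho v0 x)) \o \pi_(coset_space H) =
    psi \o rho.
  by apply/funext => g /=; rewrite psiE orbit_map_pi.
exact: continuous_dual_comp (repr_continuous rho_repr).
Qed.

Lemma char_map_continuous (tau : G -> R) : W0 H tau ->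
  continuous (char_map tau : coset_space H -> R).
Proof.
move=> tauW; apply/quotient_continuous.
have -> : char_map tau \o \pi_(coset_space H) = tau.
  by apply/funext => g /=; rewrite char_map_pi.
by case: tauW.
Qed.

Let dens (theta : dual V * (G -> R)) (x : coset_space H) : R :=
  expR (- (theta.1 (orbit_map rho v0 x) : R) + char_map theta.2 x).

Lemma dens_continuous theta : W0 H theta.2 -> continuous (dens theta).
Proof.
move=> tauW x.
apply: (@continuous_comp _ _ _
  (fun x => - (theta.1 (orbit_map rho v0 x) : R) + char_map theta.2 x) expR);
  last exact: continuous_expR.
exact: (cvgD (cvgN (@dual_orbit_continuous theta.1 x))
             (char_map_continuous tauW (x := x))).
Qed.

Lemma ptilde_gt0 theta : W0 H theta.2 ->
  nu [set: borel (coset_space H)] != 0%E ->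
  (0 < ptilde rho v0 nu theta [set: _])%E.
Proof.
move=> tauW; apply: (density_measure_gt0 (dens_continuous tauW)) => x.
  exact: expR_ge0.
exact: expR_gt0.
Qed.

(** The total mass is finite by the choice of [theta] and positive because [nu] is nonzero, so its
    extended-real inverse is a genuine real inverse. *)
Lemma norm_constE theta : Theta rho v0 nu theta ->
  nu [set: borel (coset_space H)] != 0%E ->
  exists2 z : R, 0 < z & norm_const rho v0 nu theta = z%:E /\
    (z%:E * ptilde rho v0 nu theta [set: _] = 1)%E.
Proof.
move=> [tauW Zfin] nu0; have := ptilde_gt0 tauW nu0; rewrite /norm_const.
case: (ptilde _ _ _ _ _) Zfin => [z| |]// _; rewrite lte_fin => z0.
exists z^-1; first by rewrite invr_gt0.
by rewrite inver gt_eqF// -EFinM mulVf// gt_eqF.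
Qed.

(** Absorbing the normalizing constant gives the probability measure itself a continuous positive
    density, to which [radon_density] applies. *)
Let scaled_dens z theta x := z * dens theta x.

Lemma ptilde_scaled theta z (A : set (borel (coset_space H))) :
  W0 H theta.2 -> 0 < z -> measurable A ->
  (z%:E * ptilde rho v0 nu theta A =
   \int[nu]_(x in A) (scaled_dens z theta x)%:E)%E.
Proof.
move=> tauW z0 mA; apply: (density_measureZ nu (dens_continuous tauW)) => //.
  by move=> x; exact: expR_ge0.
exact: ltW.
Qed.

Lemma scaled_dens_continuous theta z : W0 H theta.2 ->
  continuous (scaled_dens z theta).
Proof.
by move=> tauW x; exact: (cvgM (cvg_cst z) (dens_continuous tauW (x := x))).
Qed.

Lemma ptheta_ex theta : Theta rho v0 nu theta ->
  nu [set: borel (coset_space H)] != 0%E ->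
  exists p, is_ptheta rho v0 nu theta p.
Proof.
move=> thetaT nu0; have [z z0 [zE _]] := norm_constE thetaT nu0.
have [tauW _] := thetaT.
have [|p pE] := @ex_density_measure _ _ nu _
    (scaled_dens_continuous (z := z) tauW).
  by move=> x; rewrite mulr_ge0 ?expR_ge0// ltW.
by exists p => A mA; rewrite pE zE ptilde_scaled.
Qed.

Lemma ptheta_radon_probability theta p :
  hausdorff_space (coset_space H) -> is_radon nu ->
  nu [set: borel (coset_space H)] != 0%E ->
  Theta rho v0 nu theta -> is_ptheta rho v0 nu theta p ->
  is_radon p /\ p [set: borel (coset_space H)] = 1%E.
Proof.
move=> Xh nuR nu0 thetaT pE; have [z z0 [zE z1]] := norm_constE thetaT nu0.
have [tauW _] := thetaT.
have p1 : p [set: borel (coset_space H)] = 1%E.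
  by rewrite pE ?zE//; exact: measurableT.
split=> //.
apply: (radon_density Xh nuR (scaled_dens_continuous (z := z) tauW)).
- by move=> x; rewrite mulr_gt0// expR_gt0.
- by move=> A mA; rewrite pE// zE ptilde_scaled.
- by rewrite p1 ltry.
Qed.

End Method.

(** * The statistic and its canonical parameter *)

Section SufficientStatistic.
Context {R : realType} {V : vectType R} {m : nat}.

(** The minus sign compensates for the convention [exp (- eta (T x))], since characters enter the
    exponent of the method with a plus sign. *)
Lemma dual_pair (phi : dual V) (c : 'I_m -> R) :
  exists eta : dual (V * 'rV[R]_m)%type, forall v w,
     eta (v, w) = (phi v : R) - \sum_i c i * w 0 i.
Proof.
pose ev (z : V * 'rV[R]_m) : R^o := (phi z.1 : R) - \sum_i c i * z.2 0 i.
have ev_lin : linear ev.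
  move=> a y z; rewrite /ev /= linearP scalerBr addrACA -opprD; congr (_ - _).
  rewrite scaler_sumr -big_split /=; apply: eq_bigr => i _.
  by rewrite !mxE mulrDr mulrCA.
by have [eta etaE] := linear_dual ev_lin; exists eta => v w; rewrite etaE.
Qed.

(** A functional on the product splits into a functional of the first component and a linear
    combination of the [g i], so [continuous_fdtop] applies. *)
Lemma continuous_pair_fdtop (X : topologicalType) (f : X -> V)
    (g : 'I_m -> X -> R) :
  (forall phi : dual V, continuous (phi \o f : X -> R)) ->
  (forall i, continuous (g i)) ->
  continuous ((fun x => (f x, \row_i g i x)) : X -> fdtop (V * 'rV[R]_m)%type).
Proof.
move=> fc gc; apply: continuous_fdtop => eta.
pose ev (v : V) : R^o := eta (v, 0).
have ev_lin : linear ev.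
  move=> a v w; rewrite /ev -linearP; congr (eta _).
  by apply: injective_projections => //=; rewrite scaler0 addr0.
have [psi psiE] := linear_dual ev_lin.
have -> : (eta \o (fun x => (f x, \row_i g i x)) : X -> R) =
    fun x => (psi (f x) : R) + \sum_i g i x * (eta (0, delta_mx 0 i) : R).
  apply/funext => x /=; rewrite psiE /ev.
  have -> : (f x, \row_i g i x) =
      (f x, 0) + \sum_i g i x *: (0, delta_mx 0 i) :> V * 'rV[R]_m.
    apply: injective_projections => /=.
      by rewrite (raddf_sum fst) big1 ?addr0// => i _ /=; rewrite scaler0.
    rewrite (raddf_sum snd) add0r [LHS]row_sum_delta.
    by apply: eq_bigr => i _; rewrite mxE.
  rewrite linearD linear_sum; congr (_ + _).
  by apply: eq_bigr => i _; rewrite linearZ.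
move=> x; apply: cvgD; first exact: fc.
apply: continuous_sumr => i {}x; exact: (cvgM (gc i x) (cvg_cst _)).
Qed.

End SufficientStatistic.

Theorem proposition3p4 (R : realType) (G : lieGroupType R)
    (H : groupClosed G) (V : vectType R) (rho : G -> 'End(V)) (v0 : V)
    (nu : {measure set (borel (coset_space H)) -> \bar R})
    (G_components : finitely_many_components G)
    (H_closed : closed [set h : G | h \in H])
    (nu_invariant : relatively_invariant nu)
    (nu_neq0 : nu [set: borel (coset_space H)] != 0%E)
    (rho_repr : is_continuous_representation rho)
    (v0_fixed : forall h, h \in H -> rho h v0 = v0)
    (Theta_neq0 : Theta rho v0 nu !=set0) :
  is_exponential_family (method_family rho v0 nu).
Proof.
have [nu_radon _] := nu_invariant.
have X_hausdorff := coset_space_hausdorff H_closed.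
split.
- have [theta thetaT] := Theta_neq0.
  have [p pE] := ptheta_ex rho_repr v0_fixed thetaT nu_neq0.
  by exists p, theta.
- move=> p [theta thetaT pE].
  exact: (ptheta_radon_probability rho_repr v0_fixed X_hausdorff nu_radon
            nu_neq0 thetaT pE).
have [m [t [tW tspan]]] := W0_finite_dimensional H G_components.
exists nu, (V * 'rV[R]_m)%type,
  (fun x => (orbit_map rho v0 x, \row_i char_map (t i) x)); split=> //.
  apply: continuous_pair_fdtop => [phi|i]; last exact: char_map_continuous.
  exact: dual_orbit_continuous.
move=> p [[phi tau] [tauW thetaT] pE].
have [c /= cE] := tspan _ tauW.
have [eta etaE] := dual_pair phi c; exists eta.
have etaT x : - (eta (orbit_map rho v0 x, \row_i char_map (t i) x) : R) =
    - (phi (orbit_map rho v0 x) : R) + char_map tau x.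
  rewrite etaE opprB addrC; congr (_ + _).
  by rewrite /char_map cE; apply: eq_bigr => i _; rewrite mxE.
move=> A mA; apply: (etrans (pE A mA)).
(* Equality of the integrands identifies both the normalizing constants and the integrals over
   [A]. *)
have densE : (fun x : coset_space H => (expR (- (eta (orbit_map rho v0 x,
      \row_i char_map (t i) x) : R)))%:E) =
    (fun x => (expR (- (phi (orbit_map rho v0 x) : R) + char_map tau x))%:E).
  by apply/funext => x; rewrite etaT.
by rewrite densE.
Qed.
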